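(* Let $G$ be a countably infinite amenable group with a Følner sequence $F=(F_N)_{N\in\mathbb{N}}$. Let $D\subseteq\mathbb{C}$ be compact and let $C\subseteq\mathbb{C}$ be the convex hull of $D$. Then for any sequence $(z_g)_{g\in G}$ of complex numbers in $C$ there is a sequence $(w_g)_{g\in G}$ in $D$ such that, for any $k\in\mathbb{N}$ and any pairwise distinct elements $h_1,\dots,h_k\in G$, we have $$\lim_{N\to\infty}\frac{1}{|F_N|}\sum_{g\in F_N}w_{h_1g}\cdots w_{h_kg}=\lim_{N\to\infty}\frac{1}{|F_N|}\sum_{g\in F_N}z_{h_1g}\cdots z_{h_kg},$$ whenever the limit on the right hand side exists.
   Context: A (left) Følner sequence in a countable group $G$ is a sequence $F=(F_N)_{N\in\mathbb{N}}$ of (nonempty) finite subsets of $G$ such that $\lim_{N\to\infty}\frac{|gF_N\Delta F_N|}{|F_N|}=0$ for all $g\in G$; $G$ is (left) amenable if it has a Følner sequence. *)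

(* Defs.v *)
From HB Require Import structures.
From mathcomp Require Import all_boot all_order all_algebra.
From mathcomp Require Import finmap complex.
From mathcomp Require Import all_classical all_reals all_analysis.

Set Implicit Arguments.
Unset Strict Implicit.
Unset Printing Implicit Defensive.

Import Order.TTheory GRing.Theory Num.Theory.
Import numFieldNormedType.Exports.

Local Open Scope classical_set_scope.
Local Open Scope ring_scope.

(* The library puts no topology on R[i] itself, only on the regular module of
   a numFieldType; transporting the latter gives the usual topology of the
   modulus. *)
HB.instance Definition _ (R : realType) := NormedModule.copy R[i] R[i]^o.

Section Folner.
Variable G : groupType.
Implicit Types (g : G) (A B : {fset G}) (F : nat -> {fset G}).

Definition lmul_fset g A : {fset G} := [fset (g * x)%g | x in A]%fset.

Definition symdiff_fset A B : {fset G} := ((A `\` B) `|` (B `\` A))%fset.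

Definition Folner_sequence (R : realType) F : Prop :=
  (forall N, F N != fset0) /\
  forall g, (fun N => #|` symdiff_fset (lmul_fset g (F N)) (F N)|%:R
                      / #|` F N|%:R : R) @ \oo --> (0 : R).

Definition Folner_average (R : realType) F (u : G -> R[i]) (N : nat) : R[i] :=
  (#|` F N|%:R)^-1 * \sum_(g <- F N) u g.

End Folner.

(* Convexity is over the real scalars, hence the real vector space
   Rcomplex R, whose carrier is R[i]. *)
Definition convex_hull (R : realType) (D : set R[i]) : set R[i] :=
  smallest (@convex_set R (Rcomplex R)) D.

(* Main.v *)
Require Import Defs.
From HB Require Import structures.
From mathcomp Require Import all_boot all_order all_algebra.
From mathcomp Require Import finmap complex.
From mathcomp Require Import all_classical all_reals all_analysis.
From mathcomp Require Import zify ring lra.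

Set Implicit Arguments.
Unset Strict Implicit.
Unset Printing Implicit Defensive.

Import Order.TTheory GRing.Theory Num.Theory.
Import numFieldNormedType.Exports.

Local Open Scope classical_set_scope.
Local Open Scope ring_scope.

(* Enumerate [G] and choose the values [w g] in this order. The difference of
   the products of the values of [w] and of [z] at [h_1 g, ..., h_k g]
   telescopes into terms [(w x - z x) * c x], where [x] is one of the points
   [h_j g] and [c x] only depends on values of [w] chosen before [w x]. Given a
   partition of [G] into finite cells, the value [w x] can be chosen in [D] so
   that, for finitely many coefficients [c] at once, the square norm of the sum
   of these terms over the cell of [x] grows by a bounded amount, since [z x]
   is in the convex hull of [D]; so the sum over a cell [C] is of order
   [sqrt |C|]. It remains to find a single partition of [G] for which most of
   each [F N] is a union of large cells. It is glued from nested partitions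
   into cells of bounded diameter, coarser and coarser away from a
   fixed finite set. *)

(** * Half planes and bounds for convex hulls in the complex plane *)

(** Otherwise the open half plane [H], bounded by the line through [z], would be a convex set
    containing [D] but not [z]. *)
Lemma convex_hull_halfplane (R : realType) (D : set R[i]) (z : R[i]) (p q : R) :
  convex_hull D z ->
  exists2 v, D v & p * complex.Re v + q * complex.Im v <=
                   p * complex.Re z + q * complex.Im z.
Proof.
move=> zC; apply: contrapT => noD.
pose H : set R[i] := [set v | p * complex.Re z + q * complex.Im z <
                              p * complex.Re v + q * complex.Im v].
suff : H z by rewrite /H /= ltxx.
apply: zC; split=> [x y t /set_mem Hx /set_mem Hy|v Dv].
  apply/mem_set; rewrite /H /=.
  case: x Hx => xa xb; case: y Hy => ya yb.
  rewrite /H /= => Hy Hx.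
  have /andP[t0 t1] : 0 <= t%:inum <= 1 by rewrite ge0 le1.
  set a := _ + _ in Hx Hy *.
  set s := t%:inum in t0 t1 *.
  rewrite /=.
  have : a < s * (p * xa + q * xb) + (1 - s) * (p * ya + q * yb).
    have [->|s0] := eqVneq s 0; first by rewrite mul0r subr0 mul1r add0r.
    have {}s0 : 0 < s by rewrite lt_def s0.
    have h1 : s * a < s * (p * xa + q * xb) by rewrite ltr_pM2l.
    have h2 : (1 - s) * a <= (1 - s) * (p * ya + q * yb).
      by rewrite ler_wpM2l ?subr_ge0 // ltW.
    have -> : a = s * a + (1 - s) * a by ring.
    exact: ltr_leD.
  by congr (_ < _); rewrite /unstable.onem; ring.
rewrite /H /= ltNge; apply/negP => le; apply: noD; by exists v.
Qed.

(** The open discs of integer radius around 0 cover [D], so finitely many of them do. *)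
Lemma compact_complex_bounded (R : realType) (D : set R[i]) :
  compact D -> exists b : R, forall v, D v -> `|v| <= b%:C%C.
Proof.
rewrite compact_cover => Dcover.
have bigO (n : nat) : [set: nat] n -> open [set v : R[i] | `|v| < n%:R].
  move=> _; rewrite openE => v /= vn; rewrite /interior -nbhs_ballE.
  exists (n%:R - `|v|) => [|u /=]; first by rewrite /= subr_gt0.
  rewrite -ball_normE /= ltrBrDr distrC => uv.
  by rewrite (le_lt_trans _ uv)// -{1}(subrK v u) ler_normD.
have [||s _ sub] := Dcover _ [set: nat]
    (fun n : nat => [set v : R[i] | `|v| < n%:R]).
- exact: bigO.
- move=> v _; exists (Num.truncn (complex.Re `|v|)).+1 => //=.
  rewrite -(RRe_real (normr_real v)) -(rmorph_nat (real_complex R)) ltcR.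
  exact: truncnS_gt.
- exists (\max_(i <- s) i)%:R => v /sub [n ns /= /ltW vn].
  rewrite (le_trans vn)// -(rmorph_nat (real_complex R)) lecR ler_nat.
  exact: leq_bigmax_seq.
Qed.

(** Half planes in the four axis directions bound the real and imaginary parts of [z] by those of
    points of [D]. *)
Lemma convex_hull_bounded (R : realType) (D : set R[i]) :
  compact D -> exists2 b : R, 1 <= b & forall v, convex_hull D v -> `|v| <= b%:C%C.
Proof.
have norm_i : `|'i%C : R[i]| = 1.
  by rewrite normc_def /= expr0n expr1n add0r sqrtr1.
have normc_real (x : R) : `|x%:C%C| = `|x|%:C%C.
  by rewrite normc_def /= expr0n addr0 sqrtr_sqr.
move=> /compact_complex_bounded[b Db].
have ReD v : D v -> `|complex.Re v| <= b.
  by move=> /Db; rewrite -lecR; apply: le_trans; exact: normc_ge_Re.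
have ImD v : D v -> `|complex.Im v| <= b.
  move=> /Db; rewrite -lecR; apply: le_trans.
  rewrite -normrN -ReiNIm (le_trans (normc_ge_Re _))// normrM norm_i.
  by rewrite mulr1.
exists (`|b| + `|b| + 1) => [|z zD]; first by rewrite lerDr addr_ge0.
have := ler_norm b.
have [v1 /ReD v1D h1] := convex_hull_halfplane 1 0 zD.
have [v2 /ReD v2D h2] := convex_hull_halfplane (-1) 0 zD.
have [v3 /ImD v3D h3] := convex_hull_halfplane 0 1 zD.
have [v4 /ImD v4D h4] := convex_hull_halfplane 0 (-1) zD.
move=> bb.
have rez : `|complex.Re z| <= b.
  by move: v1D v2D; rewrite !ler_norml => /andP[? ?] /andP[? ?]; lra.
have imz : `|complex.Im z| <= b.
  by move: v3D v4D; rewrite !ler_norml => /andP[? ?] /andP[? ?]; lra.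
rewrite (complexE z) (le_trans (ler_normD _ _))// normrM norm_i mul1r.
rewrite !normc_real -rmorphD lecR.
lra.
Qed.

(** * Greedy balancing of sums *)

(** The squared modulus as an element of [R]; the norm on [R[i]] takes its values in [R[i]]. *)
Definition sqnormc (R : realType) (x : R[i]) : R :=
  complex.Re x ^+ 2 + complex.Im x ^+ 2.

Lemma sqnormcM (R : realType) (x y : R[i]) :
  sqnormc (x * y) = sqnormc x * sqnormc y.
Proof. by case: x => a b; case: y => c d; rewrite /sqnormc /=; ring. Qed.

Lemma sqnormc_ge0 (R : realType) (x : R[i]) : 0 <= sqnormc x.
Proof. by rewrite /sqnormc addr_ge0 ?sqr_ge0. Qed.

Lemma sqnormc_le (R : realType) (x : R[i]) (b : R) : 0 <= b ->
  (sqnormc x <= b ^+ 2) = (`|x| <= b%:C%C).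
Proof.
move=> b0; rewrite -lecR /sqnormc add_Re2_Im2 rmorphXn /=.
by rewrite ler_pXn2r ?nnegrE ?normr_ge0 ?ler0c.
Qed.

(* Expanding the squares, the cross terms form a real linear functional of
   [v - z], which is nonpositive for some [v] in [D]. *)
Lemma balancing_step (R : realType) (D : set R[i]) (z : R[i]) (n : nat)
    (S c : nat -> R[i]) : convex_hull D z ->
  exists2 v, D v & \sum_(q < n) sqnormc (S q + (v - z) * c q) <=
                   \sum_(q < n) (sqnormc (S q) + sqnormc (v - z) * sqnormc (c q)).
Proof.
(* [al q] and [be q] are the real and imaginary parts of [S q] times the conjugate of [c q]. *)
pose al (q : nat) := complex.Re (S q) * complex.Re (c q) +
                     complex.Im (S q) * complex.Im (c q).
pose be (q : nat) := complex.Im (S q) * complex.Re (c q) -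
                     complex.Re (S q) * complex.Im (c q).
move=> /(convex_hull_halfplane (\sum_(q < n) al q) (\sum_(q < n) be q)).
move=> [v Dv le_vz]; exists v => //.
have -> : \sum_(q < n) sqnormc (S q + (v - z) * c q) =
    \sum_(q < n) (sqnormc (S q) + sqnormc (v - z) * sqnormc (c q)) +
    2 * ((\sum_(q < n) al q) * complex.Re (v - z) +
         (\sum_(q < n) be q) * complex.Im (v - z)).
  rewrite !mulr_suml -big_split /= mulr_sumr -big_split /=; apply: eq_bigr => q _.
  rewrite /al /be /sqnormc.
  by case: (S q) => ? ?; case: (c q) => ? ?; case: (v - z) => ? ? /=; ring.
rewrite gerDl pmulr_rle0//; move: le_vz.
case: v {Dv} => va vb; case: z => za zb /=.
move=> le_vz; rewrite -subr_le0 in le_vz; rewrite (le_trans _ le_vz)//.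
by rewrite le_eqVlt; apply/orP; left; apply/eqP; ring.
Qed.

(** At time [t] only the sums of the cell [lab t] change, and [balancing_step] for this cell lets
    the total of its [r (lab t)] square norms grow by at most [(2 * b) ^+ 2] times the sum of the
    [K q]. Causality makes [c t] known when [w t] is chosen. *)
Lemma online_balancing (R : realType) (T : eqType) (D : set R[i])
    (z : nat -> R[i]) (lab : nat -> T) (r : T -> nat) (b : R) (K : nat -> R)
    (c : nat -> (nat -> R[i]) -> nat -> R[i]) :
  (forall t, convex_hull D (z t)) -> 1 <= b ->
  (forall v, convex_hull D v -> `|v| <= b%:C%C) ->
  (forall t u u' q, (forall i, (i < t)%N -> u i = u' i) -> c t u q = c t u' q) ->
  (forall t u q, (forall i, `|u i| <= b%:C%C) -> sqnormc (c t u q) <= K q) ->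
  exists2 w : nat -> R[i], (forall t, D (w t)) &
    forall P t, \sum_(q < r P) sqnormc
        (\sum_(i < t | lab i == P) (w i - z i) * c i w q) <=
      (2 * b) ^+ 2 * (\sum_(q < r P) K q) * (\sum_(i < t) (lab i == P))%:R.
Proof.
move=> zC b1 hb causal cK.
pose S t (u : nat -> R[i]) P q : R[i] :=
  \sum_(i < t | lab i == P) (u i - z i) * c i u q.
pose Q t u v := D v /\ \sum_(q < r (lab t)) sqnormc
    (S t u (lab t) q + (v - z t) * c t u q) <=
  \sum_(q < r (lab t))
    (sqnormc (S t u (lab t) q) + sqnormc (v - z t) * sqnormc (c t u q)).
have /choice[p pP] : forall tu : nat * (nat -> R[i]), exists v, Q tu.1 tu.2 v.
  move=> [t u] /=; have [v Dv le_v] := balancing_step (r (lab t))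
    (S t u (lab t)) (c t u) (zC t).
  by exists v.
(* [W t] holds the values chosen before time [t] and the default [z] from [t] on; by causality,
   [c t] only sees the former. *)
pose fix W t : nat -> R[i] := if t is t'.+1 then
  fun i => if i == t' then p (t', W t') else W t' i else z.
pose w t := W t.+1 t.
have wE t : w t = p (t, W t) by rewrite /w /= eqxx.
have Dw t : D (w t) by rewrite wE; exact: (pP (t, W t)).1.
have Ww t i : (i < t)%N -> W t i = w i.
  elim: t => // t IH; rewrite ltnS leq_eqVlt => /predU1P[->//|it] /=.
  by rewrite ltn_eqF ?IH.
have wb t : `|w t| <= b%:C%C by apply: hb; exact: sub_gen_smallest.
exists w => // P; elim=> [|t IH].
  rewrite [in leRHS]big_ord0 mulr0 big1// => q _.
  by rewrite big_ord0 /sqnormc /= expr0n addr0.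
rewrite big_ord_recr /=.
under eq_bigr => q _ do rewrite big_mkcond big_ord_recr -big_mkcond /=.
have [labt|] := eqVneq (lab t) P; last first.
  by move=> _; under eq_bigr => q _ do rewrite addr0; rewrite addn0.
have SE q : S t (W t) P q = \sum_(i < t | lab i == P) (w i - z i) * c i w q.
  apply: eq_bigr => i _; rewrite Ww//; congr (_ * _); apply: causal => j ji.
  by rewrite Ww// (ltn_trans ji).
have := (pP (t, W t)).2; rewrite /= -wE labt.
under eq_bigr => q _ do rewrite SE (causal t (W t) w q (Ww t)).
move=> /le_trans; apply.
under eq_bigr => q _ do rewrite SE (causal t (W t) w q (Ww t)).
rewrite big_split /= natrD mulrDr mulr1 lerD//.
rewrite -mulr_sumr ler_pM ?sqnormc_ge0 ?sumr_ge0 //.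
- by move=> q _; exact: sqnormc_ge0.
- rewrite sqnormc_le ?mulr_ge0 ?(le_trans ler01 b1)//.
  rewrite (le_trans (ler_normB _ _))// mulr_natl rmorphMn mulr2n /=.
  by rewrite lerD ?wb// hb.
- by apply: ler_sum => q _; exact: cK.
Qed.

(** * Nested partitions of an infinite group into large bounded cells *)

(** Cells are the fibres of [pi]. Take a maximal set [X] with the translates [K x], [x] in [X],
    pairwise disjoint. By maximality each representative is within bounded distance of some [x] in
    [X], to which [rho] sends it; and all of [A0 x] goes to [x], so each new cell has at least [m]
    points. *)
Lemma coarsen_partition (G : groupType) (pi : G -> G) (L : {fset G}) (m : nat) :
  infinite_set [set: G] -> (forall g, (pi g * g^-1)%g \in L) ->
  exists rho : G -> G, exists L' : {fset G},
    (forall g, (rho (pi g) * g^-1)%g \in L') /\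
    forall g, exists2 A : {fset G}, (m <= #|` A|)%N &
      forall x, x \in A -> rho (pi x) = rho (pi g).
Proof.
move=> Ginf piL.
have [A0 _ A0m] := infinite_set_fset m Ginf.
(* As [K] contains [L A0], the representatives of the points of [A0 x] lie in [K x]. *)
pose K := (1%g |` [fset (l * a)%g | l in L, a in A0])%fset.
pose B (x : G) : set G := [set y | (y * x^-1)%g \in K].
have Bx x : B x x by rewrite /B /= mulgV !inE eqxx.
have [X [_ /trivIsetP trivX maxX]] := ex_maximal_disjoint_subcollection B [set: G].
have near g : exists2 x, X x & B g `&` B x !=set0.
  apply: contrapT => noX.
  have Xg : ~ X g by move=> Xg; apply: noX; exists g => //; exists g.
  apply: (maxX (X `|` [set g])) => //.
    split; first by move=> x; left.
    by move=> /(_ g) sub; apply: Xg; apply: sub; right.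
  apply/trivIsetP => x y [Xx|->] [Xy|->] xy.
  - exact: trivX.
  - apply/eqP/negP => /negP /set0P xg; apply: noX.
    by exists x => //; rewrite setIC.
  - by apply/eqP/negP => /negP /set0P xg; apply: noX; exists y.
  - by rewrite eqxx in xy.
(* If [g] lies in some [K x], this [x] is unique and has to be chosen; otherwise any [x] with [K x]
   meeting [K g] will do. *)
have /choice[rho rhoP] : forall g, exists x,
    [/\ X x, B g `&` B x !=set0 & forall y, X y -> B y g -> x = y].
  move=> g; have [[x Xx Bxg]|noX] := pselect (exists2 x, X x & B x g).
    exists x; split=> //; first by exists g.
    move=> y Xy Byg; apply: contrapT => /eqP xy.
    have /eqP := trivX x y Xx Xy xy.
    by apply/negP/set0P; exists g.
  have [x Xx gx] := near g; exists x; split=> // y Xy Byg.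
  by case: noX; exists y.
pose L' := [fset (k.1^-1 * k.2 * l)%g | k in (K `*` K)%fset, l in L]%fset.
exists rho, L'; split=> [g|g].
  have [_ [y [/= yg yr]] _] := rhoP (pi g).
  apply/imfset2P; exists ((y * (rho (pi g))^-1)%g, (y * (pi g)^-1)%g).
    by rewrite in_fsetM; apply/andP.
  exists (pi g * g^-1)%g; first exact: piL.
  by rewrite /= invgM invgK !mulgA !mulgVK.
have [Xx _ _] := rhoP (pi g); set x := rho (pi g) in Xx *.
exists [fset (a * x)%g | a in A0]%fset.
  by rewrite card_imfset //=; exact: mulIg.
move=> y /imfsetP[/= a aA ->].
have [_ _ ] := rhoP (pi (a * x)%g); apply=> //.
rewrite /B /= !inE; apply/orP; right.
apply/imfset2P; exists (pi (a * x) * (a * x)^-1)%g; first exact: piL.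
by exists a => //; rewrite invgM !mulgA mulgVK.
Qed.

(** Coarsening is iterated from the partition into singletons. The bound on the distance of a point
    to its representative yields the bound [L n] on quotients of points of one cell. *)
Lemma nested_partitions (G : groupType) (m : nat -> nat) :
  infinite_set [set: G] ->
  exists (pi : nat -> G -> G) (L : nat -> {fset G}),
    [/\ forall n x y, pi n x = pi n y -> pi n.+1 x = pi n.+1 y,
        forall n x y, pi n x = pi n y -> (y * x^-1)%g \in L n &
        forall n g, exists2 A : {fset G}, (m n <= #|` A|)%N &
          forall x, x \in A -> pi n x = pi n g].
Proof.
move=> Ginf.
pose V (p : (G -> G) * {fset G}) := forall g, (p.1 g * g^-1)%g \in p.2.
have /choice[f fP] : forall np : nat * ((G -> G) * {fset G}),
    exists q : (G -> G) * {fset G}, V np.2 ->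
    [/\ forall x y, np.2.1 x = np.2.1 y -> q.1 x = q.1 y, V q &
        forall g, exists2 A : {fset G}, (m np.1 <= #|` A|)%N &
          forall x, x \in A -> q.1 x = q.1 g].
  move=> [n [pi L]] /=.
  have [piL|noV] := pselect (V (pi, L)); last by exists (pi, L).
  have [rho [L' [rhoL rhoA]]] := coarsen_partition (m n) Ginf piL.
  by exists (rho \o pi, L') => _; split=> //= x y ->.
pose fix Q n := if n is n'.+1 then f (n', Q n') else (id, [fset 1%g]%fset).
have VQ n : V (Q n).
  elim: n => [g|n IH]; first by rewrite /= mulgV inE.
  by have [_ ] := fP (n, Q n) IH.
(* The index is shifted because the singletons of [Q 0] may be too small for [m 0]. *)
exists (fun n => (Q n.+1).1).
exists (fun n => [fset (a^-1 * b)%g | a in (Q n.+1).2, b in (Q n.+1).2]%fset).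
split=> [n x y|n x y xy|n g].
- by have [+ _ _] := fP (n.+1, Q n.+1) (VQ n.+1); apply.
- apply/imfset2P; exists ((Q n.+1).1 y * y^-1)%g; first exact: VQ.
  exists ((Q n.+1).1 x * x^-1)%g; first exact: VQ.
  by rewrite -xy invgM invgK !mulgA mulgVK.
- by have [_ _] := fP (n, Q n) (VQ n); apply.
Qed.

(** * Invariance of Følner sets and a partition adapted to them *)

Lemma Folner_symdiff (R : realType) (G : groupType) (F : nat -> {fset G})
    (g : G) (m : nat) : Folner_sequence R F ->
  \forall N \near \oo, (m * #|` symdiff_fset (lmul_fset g (F N)) (F N)| <= #|` F N|)%N.
Proof.
move=> [F0 /(_ g)/cvgr0Pnorm_lt Fg].
(* Using [m.+1] keeps the threshold meaningful for [m = 0]. *)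
have m1 : 0 < (m.+1%:R : R)^-1 by rewrite invr_gt0 ltr0n.
near=> N.
have : `|#|` symdiff_fset (lmul_fset g (F N)) (F N)|%:R / #|` F N|%:R| < (m.+1%:R : R)^-1.
  by near: N; exact: Fg.
have FN0 : (0 < #|` F N|)%N by rewrite cardfs_gt0 F0.
rewrite ger0_norm ?divr_ge0// ltr_pdivrMr ?ltr0n// mulrC ltr_pdivlMr ?ltr0n//.
rewrite -natrM ltr_nat mulnC => /ltnW; apply: leq_trans.
by rewrite leq_mul2r leqnSn orbT.
Unshelve. all: by end_near. Qed.

(** Multiplication by [a] injects the points of [F N] that it moves out of [F N] into the symmetric
    difference of [a F N] and [F N]. Each induction step gives half of the allowance to [a] and half
    to the rest of the list. *)
Lemma Folner_invariant (R : realType) (G : groupType) (F : nat -> {fset G})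
    (s : seq G) (m : nat) : Folner_sequence R F ->
  \forall N \near \oo,
    (m * #|` [fset x in F N | ~~ all (fun a => (a * x)%g \in F N) s]%fset| <= #|` F N|)%N.
Proof.
move=> FF; elim: s m => [|a s IH] m.
  near=> N; rewrite (_ : [fset x in F N | _]%fset = fset0) ?cardfs0 ?muln0//.
  by apply/fsetP => x; rewrite !inE andbF.
near=> N.
have h1 : (m.*2 * #|` symdiff_fset (lmul_fset a (F N)) (F N)| <= #|` F N|)%N.
  by near: N; exact: (Folner_symdiff _ _ FF).
have h2 : (m.*2 * #|` [fset x in F N | ~~ all (fun a => (a * x)%g \in F N) s]%fset|
    <= #|` F N|)%N.
  by near: N; exact: IH.
pose Ba := [fset x in F N | (a * x)%g \notin F N]%fset.
pose Bs := [fset x in F N | ~~ all (fun a => (a * x)%g \in F N) s]%fset.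
have sub : ([fset x in F N | ~~ all (fun a => (a * x)%g \in F N) (a :: s)]
    `<=` Ba `|` Bs)%fset.
  by apply/fsubsetP => x; rewrite !inE /= negb_and -andb_orr.
have Bale : (#|` Ba| <= #|` symdiff_fset (lmul_fset a (F N)) (F N)|)%N.
  have -> : #|` Ba| = #|` [fset (a * x)%g | x in Ba]%fset|.
    by apply/esym/card_imfset; exact: mulgI.
  apply: fsubset_leq_card; apply/fsubsetP => y /imfsetP[/= x].
  rewrite !inE => /andP[xF axF] ->; rewrite axF /=.
  by apply/orP; left; apply/imfsetP; exists x.
have := leq_trans (fsubset_leq_card sub) (leq_card_fsetU _ _).
rewrite -/Bs in h2.
move: #|` _| #|` Ba| #|` Bs| #|` F N| #|` symdiff_fset _ _| Bale h1 h2 => u v w f t.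
by rewrite -!muln2; nia.
Unshelve. all: by end_near. Qed.

(** By invariance [F N] eventually contains a translate [A x] of any given finite set [A]. *)
Lemma Folner_card_unbounded (R : realType) (G : groupType)
    (F : nat -> {fset G}) (m : nat) :
  infinite_set [set: G] -> Folner_sequence R F ->
  \forall N \near \oo, (m <= #|` F N|)%N.
Proof.
move=> Ginf FF; have [A _ Am] := infinite_set_fset m Ginf.
near=> N.
have F0 : (0 < #|` F N|)%N by rewrite cardfs_gt0 FF.1.
have inv : (2 * #|` [fset x in F N | ~~ all (fun a => (a * x)%g \in F N) A]%fset|
    <= #|` F N|)%N.
  by near: N; exact: (Folner_invariant _ _ FF).
have [x xF /allP Ax] : exists2 x, x \in F N & all (fun a => (a * x)%g \in F N) A.
  apply: contrapT => noA; move: inv; rewrite (_ : [fset x in F N | _]%fset = F N).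
    by move: #|` _| F0 => u; lia.
  apply/fsetP => x; rewrite !inE /=; have [xF|//] := boolP (x \in F N).
  by apply/negP => Ax; apply: noA; exists x.
apply: (leq_trans Am); have -> : #|` A| = #|` [fset (a * x)%g | a in A]%fset|.
  by rewrite card_imfset//=; exact: mulIg.
by apply: fsubset_leq_card; apply/fsubsetP => y /imfsetP[/= a /Ax aF ->].
Unshelve. all: by end_near. Qed.

(* [lab x] consists of a scale and a cell of the partition at that scale; [m]
   prescribes the least size of the cells at each scale. *)
Definition union_of_large_cells (G : choiceType) (lab : G -> nat * G)
    (m : nat -> nat) (n : nat) (A : {fset G}) : Prop :=
  forall x, x \in A -> (n <= (lab x).1)%N /\
    exists C : {fset G}, [/\ (C `<=` A)%fset, (m (lab x).1 <= #|` C|)%N &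
      forall y, (y \in C) = (lab y == lab x)].

(* [U n] is the union of the [F N] with [N < tau n], rounded up to whole cells
   of the [n]-th partition, and the [n]-th partition is used on
   [U n.+1 `\` U n]. As [tau] grows fast, a set [F N] with
   [tau n.+1 <= N < tau n.+2] has few points in [U n], hence mostly meets cells
   of scale [n] or [n.+1], and it is invariant enough to be nearly a union of
   such cells. *)
Lemma Folner_adapted_partition (R : realType) (G : groupType)
    (F : nat -> {fset G}) (m : nat -> nat) :
  infinite_set [set: G] -> Folner_sequence R F ->
  exists lab : G -> nat * G, forall n : nat, \forall N \near \oo,
    exists A : {fset G}, [/\ (A `<=` F N)%fset,
      (n * #|` F N `\` A|%fset <= #|` F N|)%N & union_of_large_cells lab m n A].
Proof.
move=> Ginf FF.
have [pi [L [nest piL pim]]] := nested_partitions m Ginf.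
have nestW k n x y : (k <= n)%N -> pi k x = pi k y -> pi n x = pi n y.
  by move=> /subnK <- xy; elim: (n - k)%N => // j IH; rewrite addSn; exact: nest.
(* [Ufin n (tau n)] is a finite set containing [U n]; its size is needed to choose [tau n.+1]. *)
pose Ufin n t :=
  [fset (l * x)%g | l in L n, x in (\bigcup_(N <- iota 0 t) F N)%fset]%fset.
pose inv n N := [fset x in F N | ~~ all (fun a => (a * x)%g \in F N) (L n)]%fset.
(* The factor 2 leaves room for two exceptional sets, each taking half of the allowed error. *)
have /choice[f fP] : forall nt : nat * nat, exists t', (nt.2 < t')%N /\
    forall N, (t' <= N)%N -> (2 * nt.1.+1 * #|` inv nt.1.+1 N| <= #|` F N|)%N /\
      (2 * nt.1.+1 * #|` Ufin nt.1 nt.2| <= #|` F N|)%N.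
  move=> [n t] /=.
  have [t1 _ t1P] := Folner_invariant (L n.+1) (2 * n.+1) FF.
  have [t2 _ t2P] := Folner_card_unbounded (2 * n.+1 * #|` Ufin n t|) Ginf FF.
  exists (maxn t.+1 (maxn t1 t2)); rewrite !leq_max ltnS leqnn; split=> // N.
  by rewrite !geq_max => /and3P[_ t1N t2N]; split; [exact: t1P|exact: t2P].
pose fix tau n := if n is n'.+1 then f (n', tau n') else 0%N.
have tauS n : (tau n < tau n.+1)%N := (fP (n, tau n)).1.
have tau_mono : {homo tau : i j / (i <= j)%N}.
  by apply: homo_leq => //; [exact: leq_trans|move=> i; exact/ltnW].
have tau_ge n : (n <= tau n)%N by elim: n => // n IH; exact: leq_ltn_trans (tauS n).
pose U n (y : G) := exists2 N, (N < tau n)%N & exists2 x, x \in F N & pi n x = pi n y.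
have U_mono : forall i j y, (i <= j)%N -> U i y -> U j y.
  move=> i j y ij [N Ni [x xF xy]]; exists N; first exact: leq_trans (tau_mono _ _ ij).
  by exists x => //; exact: nestW xy.
have UUfin n y : U n y -> y \in Ufin n (tau n).
  move=> [N Nn [x xF /piL yL]]; apply/imfset2P; exists (y * x^-1)%g => //.
  exists x; last by rewrite mulgVK.
  by apply/bigfcupP; exists N => //; rewrite mem_iota add0n Nn.
(* [rank y] is the least [k] with [U k.+1 y], and 0 if there is none; [U 0] is empty since
   [tau 0 = 0]. *)
have /choice[rank rankP] : forall y, exists k, forall n, U n.+1 y -> U k.+1 y /\ ~ U k y.
  move=> y; have [[n Uy]|noU] := pselect (exists n, U n.+1 y); last first.
    by exists 0%N => n Uy; case: noU; exists n.
  have ex : exists n, `[< U n.+1 y >] by exists n; exact/asboolP.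
  exists (ex_minn ex) => _ _; case: ex_minnP => -[|k] /asboolP Uk kmin.
    by split=> // -[].
  by split=> // /asboolP /kmin; rewrite ltnn.
pose lab y := (rank y, pi (rank y) y).
(* [U k] and [U k.+1] are both unions of cells of the [k]-th partition, so the rank is constant on
   the cell of [x] at scale [rank x]. *)
have labE n x y : U n.+1 x -> pi (rank x) y = pi (rank x) x -> lab y = lab x.
  move=> /rankP [Ux nUx] yx.
  have Uy : U (rank x).+1 y.
    have [N Nt [u uF ux]] := Ux; exists N => //; exists u => //.
    by rewrite ux; apply: nest.
  have nUy : ~ U (rank x) y.
    by move=> [N Nt [u uF uy]]; apply: nUx; exists N => //; exists u; rewrite // uy.
  have [Uy' nUy'] := rankP y _ Uy.
  suff rxy : rank y = rank x by rewrite /lab rxy yx.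
  apply/eqP; rewrite eqn_leq; apply/andP; split; rewrite leqNgt; apply/negP => lt.
  - by apply: nUy'; exact: U_mono Uy.
  - by apply: nUy; exact: U_mono Uy'.
exists lab => n; exists (tau n.+1) => // N /= nN.
have [n' nn' /andP[n'N Nn']] : exists2 k, (n <= k)%N & (tau k.+1 <= N < tau k.+2)%N.
  have ex : exists k, (N < tau k)%N by exists N.+1; exact: tau_ge.
  case: (ex_minnP ex) => k Nk kmin.
  have nk : (n.+1 < k)%N.
    by rewrite ltnNge; apply/negP => /tau_mono; rewrite leqNgt (leq_ltn_trans nN).
  case: k nk Nk kmin => [//|[//|k]] nk Nk kmin; exists k => //.
  by rewrite Nk andbT leqNgt; apply/negP => /kmin; rewrite ltnn.
have FU x : x \in F N -> U n'.+2 x by move=> xF; exists N => //; exists x.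
have rank_le x : x \in F N -> (rank x <= n'.+1)%N.
  move=> /FU Ux; have [_ nU] := rankP _ _ Ux.
  by rewrite leqNgt; apply/negP => lt; apply: nU; exact: U_mono Ux.
(* The label class of [x] lies in a cell of scale at most [n'.+1], hence in the finite set
   [L n'.+1 x]. *)
pose C x := [fset y in [fset (l * x)%g | l in L n'.+1]%fset | lab y == lab x]%fset.
have CP x y : x \in F N -> (y \in C x) = (lab y == lab x).
  move=> xF; rewrite !inE /=; apply/andP/idP => [[]//|/eqP yx]; split; last exact/eqP.
  apply/imfsetP; exists (y * x^-1)%g => /=; last by rewrite mulgVK.
  apply: piL; apply: nestW (rank_le _ xF) _.
  by case: yx => -> ->.
exists [fset x in F N | ~~ `[< U n' x >] && (C x `<=` F N)%fset]%fset.
split.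
- by apply/fsubsetP => x; rewrite !inE /= => /andP[].
(* A dropped point lies in [U n'], or its cell leaves [F N], so that some element of [L n'.+1] moves
   it out of [F N]. *)
- have sub : (F N `\` [fset x in F N | ~~ `[< U n' x >] && (C x `<=` F N)%fset]
     `<=` inv n'.+1 N `|` Ufin n' (tau n'))%fset.
    apply/fsubsetP => x; rewrite in_fsetD in_fsetU !in_fset /= !inE /=.
    move=> /andP[+ xF]; rewrite xF /= negb_and negbK.
    move=> /orP[/asboolP/UUfin->|]; first by rewrite orbT.
    move=> /negP noC; apply/orP; left; apply/negP => /allP Lx; apply: noC.
    by apply/fsubsetP => y; rewrite !inE /= => /andP[/imfsetP[/= l /Lx lF ->]].
  have [] := (fP (n', tau n')).2 N n'N => /=.
  have := leq_trans (fsubset_leq_card sub) (leq_card_fsetU _ _).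
  rewrite -/(inv _ _).
  have n1 := leq_trans nn' (leqnSn n').
  move=> le_u le_v le_w; rewrite -(leq_pmul2l (isT : (0 < 2)%N)) mulnA.
  apply: (leq_trans (leq_mul (leqnn _) le_u)); rewrite mulnDr [leqRHS]mul2n -addnn.
  by apply: leq_add; [apply: leq_trans le_v|apply: leq_trans le_w];
    rewrite leq_mul2r leq_mul2l n1 !orbT.
move=> x; rewrite in_fset !inE /= => /and3P[xF xU CF].
have Ux := FU _ xF; have [Ur nUr] := rankP _ _ Ux.
split.
  rewrite (leq_trans nn')// leqNgt; apply/negP => lt; move/asboolPn: xU; apply.
  exact: U_mono Ur.
exists (C x); split; last by move=> y; exact: CP.
- apply/fsubsetP => y yC; have yF := fsubsetP CF _ yC.
  have /eqP yx : lab y == lab x by rewrite -CP.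
  rewrite in_fset !inE /= yF /=; apply/andP; split; last first.
    by apply/fsubsetP => u; rewrite CP// yx -CP// => /(fsubsetP CF).
  apply/asboolPn => yU; have [_ nUy] := rankP _ _ (FU _ yF).
  apply: nUy; apply: (U_mono _ _ _ _ yU); rewrite leqNgt; apply/negP => lt.
  move/asboolPn: xU; apply; apply: U_mono Ur.
  by case: yx lt => -> _.
- have [A mA Ax] := pim (rank x) x; apply: (leq_trans mA).
  apply: fsubset_leq_card; apply/fsubsetP => y yA; rewrite CP//.
  by apply/eqP; apply: labE Ux _; exact: Ax.
Qed.

(** * Telescoping of products of translates *)

(** The factors [y i] are replaced by [x i] one at a time, in increasing order of [rho]; term [j] is
    the change made by the replacement at [j]. *)
Lemma prodrB_rank (A : comNzRingType) (k : nat) (rho : 'I_k -> nat)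
    (x y : 'I_k -> A) : injective rho ->
  \prod_i x i - \prod_i y i =
  \sum_j (x j - y j) * \prod_(i | i != j) (if (rho i < rho j)%N then x i else y i).
Proof.
move=> rho_inj.
pose T := (\max_i rho i).+1.
pose Q t := \prod_i (if (rho i < t)%N then x i else y i).
have <- : Q T = \prod_i x i.
  by apply: eq_bigr => i _; rewrite ltnS leq_bigmax.
have <- : Q 0%N = \prod_i y i by apply: eq_bigr.
rewrite -(telescope_sumr Q (leq0n T)).
(* Ranks need not be consecutive: steps [t] that are no rank leave the product unchanged. *)
rewrite (partition_big (fun j => inord (rho j) : 'I_T) predT)//= big_mkord.
apply: eq_bigr => t _.
have rhoE j : (inord (rho j) == t :> 'I_T) = (rho j == t).
  by rewrite -val_eqE /= inordK// ltnS leq_bigmax.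
under eq_bigl do rewrite rhoE.
have [[j /eqP rj]|noj] := pselect (exists j, rho j == t); last first.
  rewrite big1 => [|j rj]; last by case: noj; exists j.
  apply/eqP; rewrite subr_eq0; apply/eqP; apply: eq_bigr => i _.
  rewrite ltnS leq_eqVlt; have [rit|//] := eqVneq (rho i) t.
  by case: noj; exists i; exact/eqP.
rewrite (big_pred1 j) => [|i]; last by rewrite -rj (inj_eq rho_inj).
rewrite /Q (bigD1 j)//= [X in _ - X](bigD1 j)//= rj ltnS leqnn ltnn.
rewrite mulrBl; congr (_ * _ - _); apply: eq_bigr => i ij.
rewrite ltnS leq_eqVlt; have [rit|//] := eqVneq (rho i) t.
by case/negP: ij; apply/eqP/rho_inj; rewrite rit.
Qed.

Lemma norm_prod_le_expr (K : numDomainType) (I : Type) (s : seq I)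
    (u : I -> K) (b : K) : (forall i, `|u i| <= b) ->
  `|\prod_(i <- s) u i| <= b ^+ size s.
Proof.
move=> ub; elim: s => [|i s IH]; first by rewrite big_nil normr1.
by rewrite big_cons normrM exprS ler_pM.
Qed.

(* The terms of the telescoped difference between a product of values of [w]
   and a product of values of [z], indexed by the largest element in the
   order given by [e]. *)
Definition balanced_term (R : realType) (G : groupType) (e : G -> nat)
    (z w : G -> R[i]) (s : seq G) (x : G) : R[i] :=
  (w x - z x) *
  \prod_(r <- s) (if (e (r * x)%g < e x)%N then w (r * x)%g else z (r * x)%g).

(** With [x = h j * g], the other points are the [r * x] for [r] in a finite list that does not
    depend on [g]. Each term is thus a translate of one fixed function. *)
Lemma prod_translatesB (R : realType) (G : groupType) (e : G -> nat)
    (z w : G -> R[i]) (k : nat) (h : 'I_k -> G) (g : G) :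
  injective e -> injective h ->
  \prod_(i < k) w (h i * g)%g - \prod_(i < k) z (h i * g)%g =
  \sum_(j < k) balanced_term e z w
    [seq (h i * (h j)^-1)%g | i <- enum 'I_k & i != j] (h j * g)%g.
Proof.
move=> e_inj h_inj; rewrite (prodrB_rank (rho := fun i => e (h i * g)%g)).
  apply: eq_bigr => j _; rewrite /balanced_term big_map big_filter big_enum_cond /=.
  by congr (_ * _); apply: eq_bigr => i _; rewrite mulgA mulgVK.
by move=> i j /e_inj /mulIg /h_inj.
Qed.

Lemma sum_label_cell (V : nmodType) (G : choiceType) (T : eqType) (en : nat -> G)
    (e : G -> nat) (lab : G -> T) (P : T) (C : {fset G}) (f : G -> V) :
  cancel en e -> cancel e en -> (forall y, (y \in C) = (lab y == P)) ->
  \sum_(i < (\max_(y <- C) e y).+1 | lab (en i) == P) f (en i) = \sum_(y <- C) f y.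
Proof.
move=> enK eK CP; set t := _.+1.
rewrite -(big_mkord (fun i => lab (en i) == P) (fun i => f (en i))) -big_filter.
rewrite -(big_map en predT f); apply: perm_big; apply: uniq_perm => //.
  by rewrite (map_inj_uniq (can_inj enK)) filter_uniq ?iota_uniq.
move=> y; apply/mapP/idP.
  by move=> [j]; rewrite mem_filter => /andP[labi _] ->; rewrite CP.
move=> yC; exists (e y); last by rewrite eK.
by rewrite mem_filter eK -CP yC /= mem_index_iota /= ltnS leq_bigmax_seq.
Qed.

(** * Balanced sequences and their sums over Følner sets *)

(** Cells of scale [n] are balanced for the first [n] lists of [sigma] only, so a single bound [B n]
    serves them all. Since [m] is fixed before [lab], the partition may be built to suit [m]. *)
Lemma exists_balanced_sequence (R : realType) (G : groupType) (D : set R[i])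
    (z : G -> R[i]) (en : nat -> G) (e : G -> nat) (b : R)
    (sigma : nat -> seq G) :
  cancel en e -> cancel e en -> 1 <= b ->
  (forall v, convex_hull D v -> `|v| <= b%:C%C) ->
  (forall g, convex_hull D (z g)) ->
  exists m : nat -> nat, forall lab : G -> nat * G,
  exists2 w : G -> R[i], (forall g, D (w g)) &
    forall (C : {fset G}) (P : nat * G) (q : nat),
      (forall y, (y \in C) = (lab y == P)) -> (m P.1 <= #|` C|)%N ->
      (q < P.1)%N ->
      `|\sum_(y <- C) balanced_term e z w (sigma q) y| <=
      #|` C|%:R / P.1.+1%:R.
Proof.
move=> enK eK b1 hb zC.
pose K q := (b ^+ size (sigma q)) ^+ 2.
pose B n := (2 * b) ^+ 2 * \sum_(q < n) K q.
(* If [|C|] is at least [B n * n.+1 ^ 2], the bound [B n * |C|] on the square norm is at most the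
   square of [|C| / n.+1]. *)
pose m n := (Num.truncn (B n * n.+1%:R ^+ 2)).+1.
exists m => lab.
pose c t (u : nat -> R[i]) q := \prod_(r <- sigma q)
  (if (e (r * en t)%g < t)%N then u (e (r * en t)%g) else z (r * en t)%g).
have b0 : 0 <= b := le_trans ler01 b1.
have [|||w0 Dw0 w0P] := @online_balancing R (nat * G)%type D
    (z \o en) (lab \o en) fst b K c _ b1 hb.
- by move=> t; exact: zC.
- move=> t u u' q uu'; apply: eq_bigr => r _.
  by case: ifP => // /uu'.
- move=> t u q ub; rewrite sqnormc_le ?exprn_ge0// rmorphXn /=.
  by apply: norm_prod_le_expr => r; case: ifP => // _; exact: hb.
exists (w0 \o e) => [g|C P q CP mC qP]; first exact: Dw0.
have := w0P P (\max_(y <- C) e y).+1.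
rewrite /= -/(B P.1) (_ : (\sum_(i < _) _)%N = #|` C|); last first.
  rewrite -big_mkcond (sum_label_cell (fun=> 1%N) enK eK CP).
  by rewrite sum1_size.
under eq_bigr => q' _.
  under eq_bigr => i _.
    rewrite (_ : _ * _ = balanced_term e z (w0 \o e) (sigma q') (en i)); last first.
      by rewrite /balanced_term /= enK.
    over.
  rewrite (sum_label_cell _ enK eK CP).
  over.
rewrite (bigD1 (Ordinal qP))//= => le_B.
have mB : B P.1 * P.1.+1%:R ^+ 2 <= #|` C|%:R.
  by rewrite (le_trans (ltW (truncnS_gt _)))// ler_nat.
have P0 : 0 < P.1.+1%:R :> R by rewrite ltr0n.
suff : sqnormc (\sum_(y <- C) balanced_term e z (w0 \o e) (sigma q) y) <=
       (#|` C|%:R / P.1.+1%:R) ^+ 2.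
  by rewrite sqnormc_le ?divr_ge0// fmorph_div !rmorph_nat.
rewrite expr_div_n ler_pdivlMr ?exprn_gt0//.
apply: (@le_trans _ _ (B P.1 * #|` C|%:R * P.1.+1%:R ^+ 2)).
  rewrite ler_wpM2r ?sqr_ge0// (le_trans _ le_B)// lerDl sumr_ge0// => i _.
  exact: sqnormc_ge0.
by rewrite mulrAC expr2 ler_wpM2r.
Qed.

Lemma norm_sum_fset_le (K : numDomainType) (T : choiceType) (A : {fset T})
    (f : T -> K) (b : K) : (forall x, `|f x| <= b) ->
  `|\sum_(x <- A) f x| <= b * #|` A|%:R.
Proof.
move=> fb; rewrite (le_trans (ler_norm_sum _ _ _))//.
rewrite (le_trans (ler_sum _ (fun x _ => fb x)))//.
by rewrite big_const_seq count_predT iter_addr_0 mulr_natr.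
Qed.

Lemma sum_fset_diff (V : zmodType) (T : choiceType) (A B : {fset T}) (f : T -> V) :
  \sum_(x <- A) f x - \sum_(x <- B) f x =
  \sum_(x <- (A `\` B)%fset) f x - \sum_(x <- (B `\` A)%fset) f x.
Proof.
have split (C E : {fset T}) : \sum_(x <- C) f x =
    \sum_(x <- (C `&` E)%fset) f x + \sum_(x <- (C `\` E)%fset) f x.
  rewrite (big_fsetID _ (mem E)) /=; congr (_ + _); apply: eq_fbigl => x;
    by rewrite !inE //= andbC.
by rewrite (split A B) (split B A) fsetIC opprD addrACA subrr add0r.
Qed.

(** The sum of [f] over [g F N] is its sum over [A], small cell by cell, corrected on three sets of
    at most [|F N| / n] points each: [F N] without [A], and the two halves of the symmetric
    difference of [g F N] and [F N]. *)
Lemma Folner_sum_translate_small (R : realType) (G : groupType)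
    (F : nat -> {fset G}) (m : nat -> nat) (lab : G -> nat * G)
    (f : G -> R[i]) (b : R) (q : nat) (g : G) (eps : R) :
  Folner_sequence R F ->
  (forall n : nat, \forall N \near \oo,
    exists A : {fset G}, [/\ (A `<=` F N)%fset,
      (n * #|` F N `\` A|%fset <= #|` F N|)%N & union_of_large_cells lab m n A]) ->
  (forall x, `|f x| <= b%:C%C) ->
  (forall (C : {fset G}) (P : nat * G), (forall y, (y \in C) = (lab y == P)) ->
     (m P.1 <= #|` C|)%N -> (q < P.1)%N ->
     `|\sum_(y <- C) f y| <= #|` C|%:R / P.1.+1%:R) ->
  0 < eps ->
  \forall N \near \oo, `|\sum_(x <- F N) f (g * x)%g| <= eps%:C%C * #|` F N|%:R.
Proof.
move=> FF labF fb cellf eps0.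
(* Scales from [n] on exceed [q], and [1 + 3 * b] counts the cells once and the three error sets. *)
pose n := maxn q.+1 (Num.truncn ((1 + 3 * b) / eps)).+1.
have n_gt0 : (0 < n)%N by rewrite leq_max.
have n0 : 0 < n%:R :> R by rewrite ltr0n.
have nR0 : 0 < n%:R :> R[i] by rewrite ltr0n.
have bn : 1 + 3 * b <= eps * n%:R.
  rewrite [leRHS]mulrC -ler_pdivrMr// (le_trans (ltW (truncnS_gt _)))// ler_nat.
  by rewrite /n leq_max leqnn orbT.
have b0 : 0 <= b%:C%C by rewrite (le_trans _ (fb 1%g)).
near=> N.
have [A [AF nA Acell]] : exists A : {fset G},
    [/\ (A `<=` F N)%fset,
      (n * #|` F N `\` A|%fset <= #|` F N|)%N & union_of_large_cells lab m n A].
  by near: N; exact: labF.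
have nS : (n * #|` symdiff_fset (lmul_fset g (F N)) (F N)| <= #|` F N|)%N.
  by near: N; exact: (Folner_symdiff _ _ FF).
have sumA : n%:R * `|\sum_(x <- A) f x| <= #|` A|%:R.
  rewrite (partition_big_imfset _ lab) /=.
  rewrite mulrC -ler_pdivlMr// (le_trans (ler_norm_sum _ _ _))//.
  rewrite -[X in X%:R / _](sum1_size A) (partition_big_imfset _ lab) /=.
  rewrite natr_sum mulr_suml big_seq [leRHS]big_seq.
  apply: ler_sum => l /imfsetP[/= x xA ->].
  have [nx [C [CA mC CP]]] := Acell x xA.
  have eqC (V : nmodType) (u : G -> V) :
      \sum_(i <- A | lab i == lab x) u i = \sum_(i <- C) u i.
    rewrite big_fset_condE; apply: eq_fbigl => i; rewrite !inE /= CP.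
    by apply: andb_idl; rewrite -CP => /(fsubsetP CA).
  rewrite !eqC sum1_size (le_trans (cellf _ _ CP mC _))//.
    by rewrite (leq_trans _ nx)// /n leq_max leqnn.
  rewrite ler_wpM2l// lef_pV2 ?posrE ?ltr0n ?n_gt0// ler_nat.
  exact: leq_trans nx (leqnSn _).
have sub3 (C : {fset G}) : (n * #|` C| <= #|` F N|)%N ->
    n%:R * `|\sum_(x <- C) f x| <= b%:C%C * #|` F N|%:R.
  move=> nC; rewrite (le_trans (ler_wpM2l _ (norm_sum_fset_le C fb)))//.
  by rewrite mulrCA ler_wpM2l// -natrM ler_nat.
have -> : \sum_(x <- F N) f (g * x)%g = \sum_(x <- A) f x +
    (\sum_(x <- (F N `\` A)%fset) f x +
    (\sum_(x <- (lmul_fset g (F N) `\` F N)%fset) f x -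
     \sum_(x <- (F N `\` lmul_fset g (F N))%fset) f x)).
  have -> : \sum_(x <- F N) f (g * x)%g = \sum_(x <- lmul_fset g (F N)) f x.
    by rewrite big_imfset //= => x y _ _; exact: mulgI.
  rewrite -sum_fset_diff.
  have := sum_fset_diff (F N) A f.
  rewrite (_ : (A `\` F N)%fset = fset0); last by apply/eqP; rewrite fsetD_eq0.
  by rewrite big_seq_fset0 subr0 => <-; ring.
rewrite -(ler_pM2l nR0).
apply: (@le_trans _ _ ((1 + 3 * b)%:C%C * #|` F N|%:R)); last first.
  rewrite mulrA ler_wpM2r// -(rmorph_nat (real_complex R)) -rmorphM lecR.
  by rewrite [leRHS]mulrC.
have -> : (1 + 3 * b)%:C%C * #|` F N|%:R = #|` F N|%:R + (b%:C%C * #|` F N|%:R +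
    (b%:C%C * #|` F N|%:R + b%:C%C * #|` F N|%:R)) :> R[i].
  rewrite rmorphD rmorph1 rmorphM rmorph_nat; ring.
rewrite (le_trans (ler_wpM2l _ (ler_normD _ _)))// mulrDr lerD//.
  by rewrite (le_trans sumA)// ler_nat fsubset_leq_card.
rewrite (le_trans (ler_wpM2l _ (ler_normD _ _)))// mulrDr lerD ?sub3//.
rewrite (le_trans (ler_wpM2l _ (ler_normB _ _)))// mulrDr lerD ?sub3//.
- by rewrite (leq_trans _ nS)// leq_mul2l fsubset_leq_card ?orbT// fsubsetUl.
- by rewrite (leq_trans _ nS)// leq_mul2l fsubset_leq_card ?orbT// fsubsetUr.
Unshelve. all: by end_near. Qed.

(** * Equality of the limits of the averages *)

Theorem proposition7p1 (R : realType) (G : groupType)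
    (Gcountable : countable [set: G]) (Ginfinite : infinite_set [set: G])
    (F : nat -> {fset G}) (FolnerF : Folner_sequence R F)
    (D : set R[i]) (compactD : compact D)
    (z : G -> R[i]) (zC : forall g, convex_hull D (z g)) :
  exists w : G -> R[i],
    (forall g, D (w g)) /\
    forall (k : nat) (h : 'I_k -> G), injective h ->
      cvgn (Folner_average F (fun g => \prod_(i < k) z (h i * g)%g)) ->
      Folner_average F (fun g => \prod_(i < k) w (h i * g)%g) @ \oo -->
        limn (Folner_average F (fun g => \prod_(i < k) z (h i * g)%g)).
Proof.
have [b b1 hb] := convex_hull_bounded compactD.
have [e [en enK eK]] : exists e : G -> nat,
    exists2 en : nat -> G, cancel en e & cancel e en.
  have /card_set_bijP[e] := eq_card_nat Gcountable Ginfinite.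
  by rewrite setTT_bijective => -[en eK enK]; exists e, en.
(* [sigma] enumerates all finite lists in [G]; a [q] that encodes no list gives the empty one. *)
pose sigma (q : nat) : seq G := oapp (map en) [::] (choice.unpickle q).
have sigmaP s : exists q, sigma q = s.
  exists (choice.pickle (map e s)); rewrite /sigma choice.pickleK /= -map_comp.
  by rewrite map_id_in// => x _ /=; rewrite eK.
have [m mP] := exists_balanced_sequence sigma enK eK b1 hb zC.
have [lab labF] := Folner_adapted_partition m Ginfinite FolnerF.
have [w Dw wP] := mP lab.
exists w; split=> // k h h_inj cvgz.
have wb g : `|w g| <= b%:C%C by apply: hb; exact: sub_gen_smallest.
have zb g : `|z g| <= b%:C%C by exact: hb.
have b0 : 0 <= b := le_trans ler01 b1.
have term_b s x : `|balanced_term e z w s x| <= (2 * b * b ^+ size s)%:C%C.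
  rewrite normrM rmorphM ler_pM//.
    rewrite (le_trans (ler_normB _ _))// mulr_natl rmorphMn mulr2n /=.
    by rewrite lerD.
  rewrite rmorphXn /=; apply: norm_prod_le_expr => r.
  by case: ifP.
set Aw := Folner_average F (fun g => \prod_(i < k) w (h i * g)%g).
set Az := Folner_average F (fun g => \prod_(i < k) z (h i * g)%g) in cvgz *.
suff diff0 : (fun N => Aw N - Az N) @ \oo --> (0 : R[i]).
  have AwE : {near \oo, (fun N => Aw N - Az N) + Az =1 Aw}.
    by apply: nearW => N; exact: subrK.
  have := cvgD diff0 cvgz; rewrite add0r => /(_ eventually_filter) AzAw.
  exact: cvg_trans (near_eq_cvg AwE) AzAw.
apply/cvgr0Pnorm_le => eps eps0.
(* A positive element of [R[i]] is real. *)
have [eps' eps'0 epsE] : exists2 eps' : R, 0 < eps' & eps = eps'%:C%C.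
  exists (complex.Re eps); last by rewrite RRe_real// gtr0_real.
  by rewrite -ltcR RRe_real// gtr0_real.
(* Each of the [k] terms gets the share [eps' / k.+1], which makes sense for [k = 0] too. *)
have k0 : 0 < k.+1%:R :> R by rewrite ltr0n.
pose T (j : 'I_k) := [seq (h i * (h j)^-1)%g | i <- enum 'I_k & i != j].
near=> N.
have small j : `|\sum_(g <- F N) balanced_term e z w (T j) (h j * g)%g| <=
    (eps' / k.+1%:R)%:C%C * #|` F N|%:R.
  move: j; near: N; apply: filter_forall => j.
  have [q qT] := sigmaP (T j).
  have epsk : 0 < eps' / k.+1%:R by rewrite divr_gt0.
  apply: (Folner_sum_translate_small (h j) FolnerF labF (term_b (T j)) _ epsk).
  by move=> C P CP mC; rewrite -qT; exact: wP.
have F0 : 0 < #|` F N|%:R :> R[i] by rewrite ltr0n cardfs_gt0 FolnerF.1.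
rewrite /Aw /Az /Folner_average -mulrBr -sumrB.
under eq_bigr => g _ do rewrite (prod_translatesB _ _ _ (can_inj eK) h_inj).
rewrite exchange_big normrM normfV normr_nat mulrC ler_pdivrMr//.
rewrite (le_trans (ler_norm_sum _ _ _))// (le_trans (ler_sum _ (fun j _ => small j)))//.
rewrite sumr_const card_ord -mulrnAl ler_wpM2r// epsE -rmorphMn lecR.
rewrite -[leLHS]mulr_natr -mulrA; apply: ler_piMr; first exact: ltW.
by rewrite mulrC ler_pdivrMr// mul1r ler_nat.
Unshelve. all: by end_near. Qed.
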